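(* Let $n\ge1$ and let $\lambda$ be a partition with $\ell(\lambda)\le n$. The multivariate Pastro polynomials $p^{(n)}_\lambda(w;A,B)$ specialize at $B=q$ (value at $B=q$ taken by continuity, i.e. as the limit $B\to q$, for generic $A,q,t$) to $$p^{(n)}_\lambda(w_1,\dots,w_n;A,q)=\frac{\tilde C^-_\lambda(t)}{\tilde C^0_\lambda(t^n)}\big(Aq^{-1/2}t^{n-1}\big)^{|\lambda|}t^{-n(\lambda)}\,R^{*(n)}_{T,\lambda}(w_1,\dots,w_n),$$ where $R^{*(n)}_{T,\lambda}$ is the Macdonald polynomial $P_\lambda(w_1,\dots,w_n;q,t)$; thus at $B=q$ they are, up to a constant, the Macdonald polynomials.
   Context: For a partition $\lambda$: $\lambda'$ is the conjugate, $|\lambda|=\sum\lambda_i$, $\ell(\lambda)$ the length, $(i,j)\in\lambda$ means $1\le j\le\lambda_i$, and $n(\lambda)=\sum_{(i,j)\in\lambda}(i-1)$ (not to be confused with the number $n$ of variables). $\mu\subset\lambda$ is inclusion of diagrams; $\mu\prec'\lambda$ means $\mu\subset\lambda$ and $\lambda'_j-\mu'_j\in\{0,1\}$ for all $j$. Define $\tilde C^0_\lambda(x)=\prod_{(i,j)\in\lambda}(1-q^{j-1}t^{1-i}x)$, $\tilde C^-_\lambda(x)=\prod_{(i,j)\in\lambda}(1-q^{\lambda_i-j}t^{\lambda'_j-i}x)$. For $\mu\prec'\lambda$ let $$\psi_{\lambda/\mu}=\prod_{(i,j)\in\lambda,\ \lambda'_j=\mu'_j}\frac{(1-q^{\lambda_i-j+1}t^{\lambda'_j-i})(1-q^{\mu_i-j}t^{1+\mu'_j-i})}{(1-q^{\mu_i-j+1}t^{\mu'_j-i})(1-q^{\lambda_i-j}t^{1+\lambda'_j-i})}.$$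 For $\epsilon\in\{T,E2\}$ define $R^{*(n)}_{\epsilon,\lambda}$ recursively by $R^{*(0)}_{\epsilon,0}=1$, $R^{*(0)}_{\epsilon,\lambda}=0$ for $\lambda\neq0$, and $R^{*(n+1)}_{\epsilon,\lambda}(z_1,\dots,z_n,v)=\sum_{\kappa\prec'\lambda}c_{\epsilon,\lambda,\kappa}R^{*(n)}_{\epsilon,\kappa}(z_1,\dots,z_n)$, where $$c_{T,\lambda,\kappa}=\psi_{\lambda/\kappa}v^{|\lambda|-|\kappa|},\qquad c_{E2,\lambda,\kappa}=\psi_{\lambda/\kappa}\frac{\tilde C^0_\lambda(t^na/v)\,\tilde C^0_\kappa(\frac q{btv})}{\tilde C^0_\kappa(t^na/v)\,\tilde C^0_\lambda(\frac q{bv})}t^{|\kappa|};$$ $R^{*(n)}_{E2,\lambda}=R^{*(n)}_{E2,\lambda}(z_i;a,b)$ depends on parameters $a,b$. Define $$\binom\lambda\mu_{E2,[b]}=q^{|\mu|}t^{n(\mu)}\frac{\tilde C^0_\mu(1/b)}{\tilde C^-_\mu(q)}R^{*(m)}_{E2,\mu}(q^{\lambda_1},q^{\lambda_2}t^{-1},\dots,q^{\lambda_m}t^{1-m};t^{1-m},b)$$ for any $m>\ell(\lambda),\ell(\mu)$ (independent of $m$). Finally, the multivariate Pastro polynomials are $$p^{(n)}_\lambda(w;A,B)=\frac{\tilde C^0_\lambda(\frac Bq)}{\tilde C^0_\lambda(\frac{t^{n-1}AB}q)}\big(At^{n-1}\big)^{|\lambda|}\sum_{\mu\subset\lambda}\binom\lambda\mu_{E2,[B/q]}\frac{\tilde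 C^-_\mu(t)\,\tilde C^0_\mu(At^{n-1})}{\tilde C^0_\mu(t^n)\,\tilde C^0_\mu(\frac qB)}R^{*(n)}_{T,\mu}\Big(\frac{w_iq^{1/2}}B\Big)t^{-n(\mu)}.$$ *)

(* Defs.v *)
From HB Require Import structures.
From mathcomp Require Import all_boot all_order all_algebra.
From mathcomp Require Import all_classical topology normedtype.

Set Implicit Arguments.
Unset Strict Implicit.
Unset Printing Implicit Defensive.

Import Order.TTheory GRing.Theory Num.Theory.
Import numFieldNormedType.Exports.

Local Open Scope ring_scope.

(* A partition is the weakly decreasing list of its nonzero parts.  Rows,
   columns and boxes are numbered from 1. *)
Definition is_partition (la : seq nat) : bool :=
  sorted geq la && (0%N \notin la).

Definition part (la : seq nat) (i : nat) : nat := nth 0%N la i.-1.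

Definition conjpart (la : seq nat) (j : nat) : nat := count (leq j) la.

Definition subpart (mu la : seq nat) : bool :=
  all (fun i => (part mu i <= part la i)%N) (iota 1 (size mu)).

(* mu -<' la.  Columns j > la_1 are empty in both diagrams. *)
Definition hstrip (mu la : seq nat) : bool :=
  subpart mu la &&
  all (fun j => (conjpart la j - conjpart mu j <= 1)%N) (iota 1 (part la 1)).

Definition boxes (la : seq nat) : seq (nat * nat) :=
  [seq (i, j) | i <- iota 1 (size la), j <- iota 1 (part la i)].

Definition nstat (la : seq nat) : nat := (\sum_(s <- boxes la) (s.1 - 1))%N.

Fixpoint subparts_le (b : nat) (la : seq nat) : seq (seq nat) :=
  if la is l :: la' then
    [::] :: [seq k :: ka | k <- iota 1 (minn b l), ka <- subparts_le k la']
  else [:: [::]].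

(* All partitions mu contained in la, each listed once: see mem_subparts and
   subparts_uniq. *)
Definition subparts (la : seq nat) : seq (seq nat) :=
  subparts_le (head 0%N la) la.

Lemma is_partition_cons k s : is_partition (k :: s) =
  [&& (0 < k)%N, (head 0%N s <= k)%N & is_partition s].
Proof.
rewrite /is_partition /= inE negb_or lt0n (eq_sym 0%N).
case: s => [|l s] /=; first by case: (k != 0%N).
rewrite inE negb_or.
by case: (k != 0%N); case: (l <= k)%N; rewrite ?andbF.
Qed.

Lemma subpart_cons k s l la :
  subpart (k :: s) (l :: la) = (k <= l)%N && subpart s la.
Proof.
rewrite /subpart /= /part /=; congr andb.
rewrite (iotaDl 1 1) all_map; apply: eq_in_all => i.
by rewrite mem_iota => /andP[]; case: i.
Qed.

Lemma mem_subparts_le b la mu : (mu \in subparts_le b la) =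
  [&& is_partition mu, subpart mu la & (head 0%N mu <= b)%N].
Proof.
elim: la b mu => [|l la IH] b [|k mu] //.
  rewrite /= mem_seq1 /=; symmetry; apply/negbTE.
  rewrite is_partition_cons /subpart /= /part /= leqn0.
  by case: k => [|k]; rewrite ?andbF.
rewrite /= in_cons /=; apply/allpairsPdep/idP => [[x [s []]]|].
  rewrite mem_iota add1n ltnS leq_min => /and3P[x0 xb xl] + [-> ->].
  rewrite IH => /and3P[ps ss hs].
  by rewrite is_partition_cons subpart_cons x0 hs ps xl ss xb.
rewrite is_partition_cons subpart_cons => /and3P[/and3P[k0 hk pm] /andP[kl sm] kb].
exists k, mu; split=> //.
  by rewrite mem_iota add1n ltnS leq_min k0 kb.
by rewrite IH pm sm.
Qed.

Lemma mem_subparts la mu :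
  (mu \in subparts la) = is_partition mu && subpart mu la.
Proof.
rewrite mem_subparts_le; case: (is_partition mu) => //=.
case: mu la => [|k mu] [|l la] //=; rewrite ?andbT //.
  by rewrite /subpart /= /part /=; case: k => [|k] /=; rewrite ?andbT.
by rewrite subpart_cons; case: (k <= l)%N; rewrite ?andbT ?andbF.
Qed.

Lemma subparts_uniq la : uniq (subparts la).
Proof.
rewrite /subparts; elim: la (head _ _) => [|l la IH] b //=.
apply/andP; split; first by apply/allpairsPdep => -[x [s []]].
by apply: allpairs_uniq_dep => [||[x s] [y u] _ _ [-> ->]] //; apply: iota_uniq.
Qed.

Section MacdonaldTypeFunctions.

Variables (K : numFieldType) (q t : K).

Definition C0 (la : seq nat) (x : K) : K :=
  \prod_(s <- boxes la) (1 - q ^ (s.2%:Z - 1) * t ^ (1 - s.1%:Z) * x).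

Definition Cminus (la : seq nat) (x : K) : K :=
  \prod_(s <- boxes la)
     (1 - q ^ ((part la s.1)%:Z - s.2%:Z)
        * t ^ ((conjpart la s.2)%:Z - s.1%:Z) * x).

(* The rational function C0 la x / C0 mu x in x, for mu contained in la, as the
   product over the boxes of la / mu (see C0_skewE).  The binomial coefficients
   evaluate this quotient at points x where C0 mu x and C0 la x may both
   vanish, so that the field quotient C0 la x / C0 mu x would be wrong there. *)
Definition C0_skew (la mu : seq nat) (x : K) : K :=
  \prod_(s <- boxes la | s \notin boxes mu)
     (1 - q ^ (s.2%:Z - 1) * t ^ (1 - s.1%:Z) * x).

Definition psi (la mu : seq nat) : K :=
  \prod_(s <- boxes la | conjpart la s.2 == conjpart mu s.2)
    (let i := s.1%:Z in let j := s.2%:Z in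
     let lai := (part la s.1)%:Z in let mui := (part mu s.1)%:Z in
     let laj := (conjpart la s.2)%:Z in let muj := (conjpart mu s.2)%:Z in
     ((1 - q ^ (lai - j + 1) * t ^ (laj - i))
        * (1 - q ^ (mui - j) * t ^ (1 + muj - i)))
     / ((1 - q ^ (mui - j + 1) * t ^ (muj - i))
        * (1 - q ^ (lai - j) * t ^ (1 + laj - i)))).

(* c n la ka v is the coefficient in the step from n to n + 1 variables, v being
   the last variable. *)
Fixpoint Rstar (c : nat -> seq nat -> seq nat -> K -> K) (n : nat)
    (la : seq nat) : ('I_n -> K) -> K :=
  match n return ('I_n -> K) -> K with
  | 0 => fun _ => (la == [::])%:R
  | n'.+1 => fun z =>
      \sum_(ka <- subparts la | hstrip ka la)
         c n' la ka (z ord_max) *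
         Rstar c ka (fun i : 'I_n' => z (widen_ord (leqnSn n') i))
  end.

Definition cT (n : nat) (la ka : seq nat) (v : K) : K :=
  psi la ka * v ^+ (sumn la - sumn ka).

Definition cE2 (a b : K) (n : nat) (la ka : seq nat) (v : K) : K :=
  psi la ka
  * (C0_skew la ka (t ^+ n * a / v) * C0 ka (q / (b * t * v))
     / C0 la (q / (b * v)))
  * t ^+ sumn ka.

(* psi la ka is the product of b_ka(s) / b_la(s), with
   b_la(s) = (1 - q^arm t^(leg+1)) / (1 - q^(arm+1) t^leg), over the columns that
   do not meet la / ka, so that this recursion is the branching rule of the
   Macdonald polynomial P_la(z_1, ..., z_n; q, t). *)
Definition RstarT (n : nat) (la : seq nat) (z : 'I_n -> K) : K :=
  Rstar cT la z.

Definition RstarE2 (n : nat) (la : seq nat) (z : 'I_n -> K) (a b : K) : K :=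
  Rstar (cE2 a b) la z.

(* The value does not depend on m, as long as m exceeds the lengths of la and
   mu. *)
Definition binomE2 (m : nat) (b : K) (la mu : seq nat) : K :=
  q ^+ sumn mu * t ^+ nstat mu * (C0 mu b^-1 / Cminus mu q)
  * RstarE2 mu
      (fun i : 'I_m => q ^+ part la i.+1 * t ^ (1 - i.+1%:Z)) (t ^ (1 - m%:Z)) b.

(* sq is a square root of q; m is the auxiliary integer of binomE2. *)
Definition pastro (sq : K) (m n : nat) (la : seq nat) (w : 'I_n -> K)
    (A B : K) : K :=
  C0 la (B / q) / C0 la (t ^ (n%:Z - 1) * A * B / q)
  * (A * t ^ (n%:Z - 1)) ^+ sumn la
  * \sum_(mu <- subparts la)
      binomE2 m (B / q) la mu
      * ((Cminus mu t * C0 mu (A * t ^ (n%:Z - 1)))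
         / (C0 mu (t ^+ n) * C0 mu (q / B)))
      * RstarT mu (fun i => w i * sq / B)
      * t ^- nstat mu.

Lemma mem_boxes la i j :
  ((i, j) \in boxes la) = [&& (0 < i)%N, (0 < j)%N & (j <= part la i)%N].
Proof.
apply/allpairsPdep/and3P => [[x [y []]]|[i0 j0 jl]].
  rewrite !mem_iota !add1n !ltnS => /andP[x0 _] /andP[y0 yl] [-> ->].
  by split.
exists i, j; split=> //; rewrite mem_iota add1n ltnS ?i0 ?j0 //=.
case: i i0 jl => // i _; rewrite /part /= => jl; rewrite ltnNge; apply/negP => h.
by move: jl; rewrite nth_default // leqNgt j0.
Qed.

Lemma boxes_uniq la : uniq (boxes la).
Proof.
apply: allpairs_uniq_dep => [|i _|[i j] [i' j'] _ _ [-> ->]] //;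
  exact: iota_uniq.
Qed.

Lemma C0_skewE la mu x : subpart mu la ->
  C0_skew la mu x * C0 mu x = C0 la x.
Proof.
move=> sml; rewrite /C0 [RHS](bigID (fun s => s \notin boxes mu)) /=.
congr (_ * _); rewrite -[RHS]big_filter; apply: perm_big.
apply: uniq_perm; [exact: boxes_uniq|exact/filter_uniq/boxes_uniq|].
move=> [i j]; rewrite mem_filter negbK; case: (boolP (_ \in _)) => //=.
rewrite !mem_boxes => /and3P[-> ->] /= jm; symmetry; apply: (leq_trans jm).
have [ilt|ige] := ltnP i.-1 (size mu); last by rewrite /part nth_default.
case: i jm ilt => [|i] jm ilt; first by case: mu la sml jm ilt => // k mu [|l la] //= /andP[].
by move/allP: sml; apply; rewrite mem_iota add1n ltnS.
Qed.

End MacdonaldTypeFunctions.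

(* Genericity of q, t, A: no relation q^i t^j = 1 with (i, j) <> (0, 0), and
   A is not of the form q^i t^j. *)
Definition generic (K : numFieldType) (A q t : K) : Prop :=
  [/\ q != 0, t != 0,
      forall i j : int, q ^ i * t ^ j = 1 -> i = 0 /\ j = 0
    & forall i j : int, A * q ^ i * t ^ j != 1].

(* Main.v *)
Require Import Defs.
From mathcomp Require Import all_boot all_order all_algebra.
From mathcomp Require Import all_classical topology normedtype.
From mathcomp Require Import zify ring.
Import Order.TTheory GRing.Theory Num.Theory.
Import numFieldNormedType.Exports.
Local Open Scope classical_set_scope.
Local Open Scope ring_scope.

Set Implicit Arguments.
Unset Strict Implicit.
Unset Printing Implicit Defensive.

Local Arguments conjpart : simpl never.

(** Put b = B / q, so that b tends to 1.  Since C0 la b vanishes at b = 1, only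
    the poles at b = 1 of the interpolation functions R_mu(q^la t^(1-i); b)
    matter.  In the branching sum for R_mu, the zero of a denominator coming from
    the box (i, la_i), i > 1, is compensated by the box (i - 1, la_i) in the
    numerator, so a pole can only come from the first variable, and only from
    chains of horizontal strips all of whose first rows have length la_1.
    Removing these first rows turns the singular part of R_mu for la into a
    multiple of R_(mu minus its first row) for la minus its first row.  By
    induction C0 la b * R_mu tends to 0 for mu <> la, and for mu = la to a
    product which telescopes to Cminus la q / (q^|la| t^n(la)).  Hence only
    mu = la survives in the Pastro sum. *)

(** * Partitions, conjugate partitions and strips *)

Lemma partition_behead la : is_partition la -> is_partition (behead la).
Proof. by case: la => // l la; rewrite is_partition_cons => /and3P[]. Qed.

Lemma nth_partition_le_head la i :
  is_partition la -> (nth 0%N la i <= head 0%N la)%N.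
Proof.
elim: la i => [|l la IH] [|i] //; rewrite is_partition_cons => /and3P[_ hl /IH h].
exact: leq_trans (h i) hl.
Qed.

Lemma nth_partitionS la i :
  is_partition la -> (nth 0%N la i.+1 <= nth 0%N la i)%N.
Proof.
elim: la i => [|l la IH] [|i] //; rewrite is_partition_cons => /and3P[_ hl /IH h].
  by rewrite /= nth0.
exact: h.
Qed.

Lemma conjpart_cons l la j :
  conjpart (l :: la) j = ((j <= l) + conjpart la j)%N.
Proof. by []. Qed.

(** Both sides say that column [j] meets the row of index [i], where [nth] counts rows from 0. In
    the induction, a first row shorter than [j] leaves the whole column empty. *)
Lemma ltn_conjpart la i j : is_partition la -> (0 < j)%N ->
  (i < conjpart la j)%N = (j <= nth 0%N la i)%N.
Proof.
move=> + j0; elim: la i => [|l la IH] i.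
  by rewrite nth_nil; case: j j0.
rewrite is_partition_cons conjpart_cons => /and3P[_ hl pla].
have [jl|lj] := leqP j l; first by case: i => //= i; rewrite add1n ltnS IH.
have -> : conjpart la j = 0%N.
  apply/eqP; rewrite -leqn0 leqNgt IH // nth0 -ltnNge.
  exact: leq_ltn_trans lj.
rewrite ltn0; symmetry; apply/negbTE; rewrite -ltnNge.
case: i => //= i; apply: leq_ltn_trans (leq_ltn_trans hl lj).
exact: nth_partition_le_head.
Qed.

Lemma conjpart_eq0 la j : is_partition la -> (head 0%N la < j)%N ->
  conjpart la j = 0%N.
Proof.
move=> pla lj; apply/eqP; rewrite -leqn0 leqNgt ltn_conjpart ?nth0 -?ltnNge //.
exact: leq_trans lj.
Qed.

(** Columns beyond the first part are empty, so the bounded check extends to every positive [j]; the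
    bound is put additively to avoid truncated subtraction. *)
Lemma hstripP ka la : is_partition la ->
  reflect (subpart ka la /\
           forall j, (0 < j)%N -> (conjpart la j <= (conjpart ka j).+1)%N)
    (hstrip ka la).
Proof.
move=> pla; apply: (iffP andP) => -[ss h]; split=> //.
  move=> j j0; have [jl|lj] := leqP j (part la 1).
    have /(allP h) : j \in iota 1 (part la 1) by rewrite mem_iota add1n ltnS j0.
    lia.
  by rewrite conjpart_eq0 // -nth0.
by apply/allP => j; rewrite mem_iota => /andP[/h]; lia.
Qed.

(** A column loses at most its bottom box, so a box lying just above a box of [la] survives in [ka].
    This supplies the zero that cancels a pole in [has_limit_cE2]. *)
Lemma hstrip_boxes ka la n p : is_partition la -> is_partition ka ->
  hstrip ka la -> (0 < n)%N -> (n.+1, p) \in boxes la -> (n, p) \in boxes ka.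
Proof.
move=> pla pka /hstripP-/(_ pla)[_ h] n0; rewrite !mem_boxes => /and3P[_ p0].
rewrite /part /= -ltn_conjpart // n0 p0 /= -ltn_conjpart //.
move: (h p p0); lia.
Qed.

Lemma hstrip_cons l ka nu : is_partition (l :: nu) -> is_partition (l :: ka) ->
  hstrip (l :: ka) (l :: nu) = hstrip ka nu.
Proof.
move=> pn pk; have [pnu pka] := (partition_behead pn, partition_behead pk).
apply/hstripP/hstripP => // -[ss h]; move: ss; rewrite subpart_cons leqnn => ss;
  split=> // j j0; move: (h j j0); rewrite !conjpart_cons; lia.
Qed.

(** * Diagrams with the first row removed *)

Lemma boxes_cons l nu : boxes (l :: nu) =
  [seq (1%N, j) | j <- iota 1 l] ++ [seq (s.1.+1, s.2) | s <- boxes nu].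
Proof.
rewrite /boxes /=; congr (_ ++ _).
rewrite map_allpairs (iotaDl 1 1) -map_comp; congr flatten; apply/eq_in_map.
by move=> i; rewrite mem_iota => /andP[]; case: i.
Qed.

Lemma mem_boxes_cons l nu i j : (0 < i)%N ->
  ((i.+1, j) \in boxes (l :: nu)) = ((i, j) \in boxes nu).
Proof. by case: i => // i _; rewrite !mem_boxes. Qed.

Lemma subpart_behead la : is_partition la -> subpart (behead la) la.
Proof.
move=> pla; apply/allP => i _.
by case: i => [|i]; rewrite /part /= !nth_behead nth_partitionS.
Qed.

(* The last boxes of the columns of la, listed by rows. *)
Lemma perm_rim_rows la m : is_partition la -> (size la <= m)%N ->
  perm_eq [seq s <- boxes la | s \notin boxes (behead la)]
    [seq (i.+1, j) | i <- iota 0 m,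
       j <- iota (nth 0%N la i.+1).+1 (nth 0%N la i - nth 0%N la i.+1)].
Proof.
move=> pla sm; apply: uniq_perm.
- exact/filter_uniq/boxes_uniq.
- by apply: allpairs_uniq_dep => [|i _|[i j] [i' j'] _ _ [-> ->]] //; exact: iota_uniq.
move=> [i j]; rewrite mem_filter !mem_boxes; apply/idP/allpairsPdep.
  case: i => // i; rewrite /part /= nth_behead => /andP[].
  move=> + /andP[j0 jl]; rewrite j0 /= -ltnNge => lj; exists i, j; split=> //.
    rewrite mem_iota /= add0n; apply: leq_trans sm.
    rewrite ltnNge; apply/negP => /(nth_default 0%N) h.
    by move: jl; rewrite h; lia.
  by rewrite mem_iota; lia.
move=> [x [y []]]; rewrite !mem_iota => /andP[_ xm] h [-> ->].
rewrite /part /= nth_behead; move: h (nth_partitionS x pla); lia.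
Qed.

(** Deleting the first row moves the diagram up by one, so exactly the bottom box of each column
    falls outside. Comparing this listing with the one by rows converts products over rows into
    products over columns. *)
Lemma perm_rim_columns la : is_partition la ->
  perm_eq [seq s <- boxes la | s \notin boxes (behead la)]
    [seq (conjpart la j, j) | j <- iota 1 (head 0%N la)].
Proof.
move=> pla; apply: uniq_perm.
- exact/filter_uniq/boxes_uniq.
- by rewrite map_inj_uniq ?iota_uniq // => j j' [].
move=> [i j]; rewrite mem_filter !mem_boxes; apply/idP/mapP.
  case: i => // i; rewrite /part /= nth_behead => /andP[].
  move=> + /andP[j0 jl]; rewrite j0 /= -ltn_conjpart // => lj; exists j.
    by rewrite mem_iota; move: (nth_partition_le_head i pla); lia.
  by move: jl; rewrite -ltn_conjpart // => jl; congr pair; lia.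
move=> [y]; rewrite mem_iota => /andP[y0 yl] [-> ->].
have : (0 < conjpart la y)%N by rewrite ltn_conjpart // nth0; lia.
case E : (conjpart la y) => [//|c] _.
rewrite y0 /part /= nth_behead -!ltn_conjpart // E; lia.
Qed.

Lemma sumn_conjpart l la : all (leq^~ l) la ->
  (\sum_(j <- iota 1 l) conjpart la j)%N = sumn la.
Proof.
elim: la => [|p la IH]; first by move=> _; rewrite big1.
move=> /andP[pl /IH {}IH]; rewrite [RHS]/= -IH.
under eq_bigr do rewrite conjpart_cons.
rewrite big_split /=; congr addn.
rewrite -(subnKC pl) iotaD big_cat /= [X in (_ + X)%N]big1_seq ?addn0.
  rewrite -[RHS](size_iota 1 p) -sum1_size; apply: eq_big_seq => j.
  by rewrite mem_iota; lia.
by move=> j; rewrite mem_iota; lia.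
Qed.

Lemma partition_all_le l la : is_partition (l :: la) -> all (leq^~ l) la.
Proof.
move=> pla; apply/(all_nthP 0%N) => i il.
exact: (nth_partition_le_head i.+1 pla).
Qed.

Lemma nstat_cons l la : nstat (l :: la) = (nstat la + sumn la)%N.
Proof.
have sz s : size (boxes s) = sumn s.
  rewrite /boxes size_allpairs_dep -[s in RHS](mkseq_nth 0%N) /mkseq.
  rewrite (iotaDl 1 0) -map_comp; congr sumn; apply: eq_map => i /=.
  by rewrite size_iota.
rewrite /nstat boxes_cons big_cat big_map /= big1 ?add0n // big_map /=.
rewrite -sz -sum1_size -big_split /=; apply: eq_big_seq => -[i j].
by rewrite mem_boxes /=; lia.
Qed.

Lemma sumn_subpart ka la :
  is_partition ka -> subpart ka la -> (sumn ka <= sumn la)%N.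
Proof.
elim: ka la => [|k ka IH] [|l la] //; rewrite is_partition_cons => /and3P[k0 _ pka].
  by rewrite /subpart /= /part /= leqn0 (gtn_eqF k0).
by rewrite subpart_cons => /andP[kl /(IH _ pka)]; apply: leq_add.
Qed.

Lemma subpart_head ka la : subpart ka la -> (head 0%N ka <= head 0%N la)%N.
Proof.
by case: ka => // k ka /allP/(_ 1%N); rewrite mem_iota /= /part nth0; apply.
Qed.

Lemma is_partition_cons_subpart l ka nu : is_partition (l :: nu) ->
  is_partition ka -> subpart ka nu -> is_partition (l :: ka).
Proof.
rewrite !is_partition_cons => /and3P[-> h _] -> ss; rewrite andbT /=.
exact: leq_trans (subpart_head ss) h.
Qed.

(** Reindexes the terms of the branching sum that keep the first row, so that they become the
    branching sum of [nu]. *)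
Lemma perm_hstrips_same_head l nu : is_partition (l :: nu) ->
  perm_eq [seq ka <- subparts (l :: nu) | hstrip ka (l :: nu) && (head 0%N ka == l)]
    [seq l :: ka | ka <- subparts nu & hstrip ka nu].
Proof.
move=> pl; have l0 : (0 < l)%N by move: pl; rewrite is_partition_cons => /andP[].
apply: uniq_perm.
- exact/filter_uniq/subparts_uniq.
- by rewrite map_inj_uniq ?filter_uniq ?subparts_uniq // => x y [].
move=> ka; rewrite mem_filter mem_subparts; apply/idP/mapP.
  case: ka => [|k ka] /=; first by rewrite [0%N == l]eq_sym (gtn_eqF l0) andbF.
  move=> /andP[/andP[hs /eqP kl] /andP[pk]]; rewrite {}kl in hs pk *.
  rewrite subpart_cons leqnn /= => ss; exists ka => //.
  by rewrite mem_filter mem_subparts -(hstrip_cons pl pk) hs ss (partition_behead pk).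
move=> [s]; rewrite mem_filter mem_subparts => /and3P[hs ps ss] ->.
have pls := is_partition_cons_subpart pl ps ss.
by rewrite hstrip_cons // hs pls subpart_cons leqnn ss /= eqxx.
Qed.

(** * Limits of finite sums and products along a filter *)

Section Limits.
Context {K : numFieldType} {T : Type} {F : set_system T} {FF : Filter F}.
Implicit Types f g : T -> K.

Definition has_limit f : Prop := exists l : K, f x @[x --> F] --> l.

Lemma cvg_near_eq f g (l : K) : (\forall x \near F, f x = g x) ->
  g x @[x --> F] --> l -> f x @[x --> F] --> l.
Proof.
by move=> fg gl; apply: cvg_trans gl; apply: near_eq_cvg; apply: filterS fg => x ->.
Qed.

Lemma has_limitM f g : has_limit f -> has_limit g ->
  has_limit (fun x => f x * g x).
Proof. by move=> [a fa] [c gc]; exists (a * c); apply: cvgM. Qed.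

Lemma has_limitD f g : has_limit f -> has_limit g ->
  has_limit (fun x => f x + g x).
Proof. by move=> [a fa] [c gc]; exists (a + c); apply: cvgD. Qed.

Lemma has_limit_cst (c : K) : has_limit (fun=> c).
Proof. by exists c; apply: cvg_cst. Qed.

Lemma has_limit_sum (I : eqType) (r : seq I) (P : pred I) (f : I -> T -> K) :
  (forall i, i \in r -> P i -> has_limit (f i)) ->
  has_limit (fun x => \sum_(i <- r | P i) f i x).
Proof.
elim: r => [|i r IH] h.
  have -> : (fun x => \sum_(i <- [::] | P i) f i x) = fun=> 0.
    by apply/funext => x; rewrite big_nil.
  exact: has_limit_cst.
have {}IH : has_limit (fun x => \sum_(i <- r | P i) f i x).
  by apply: IH => j jr; apply: h; rewrite inE jr orbT.
have -> : (fun x => \sum_(i <- i :: r | P i) f i x) = fun x =>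
    if P i then f i x + \sum_(i <- r | P i) f i x else \sum_(i <- r | P i) f i x.
  by apply/funext => x; rewrite big_cons.
case: (boolP (P i)) => Pi //.
by apply: has_limitD => //; apply: h; rewrite ?inE ?eqxx.
Qed.

Lemma cvg_sum_seq (I : eqType) (r : seq I) (f : I -> T -> K) (l : I -> K) :
  (forall i, i \in r -> f i x @[x --> F] --> l i) ->
  \sum_(i <- r) f i x @[x --> F] --> \sum_(i <- r) l i.
Proof.
move=> h; rewrite big_seq.
have -> : (fun x => \sum_(i <- r) f i x) = fun x => \sum_(i <- r | i \in r) f i x.
  by apply/funext => x; rewrite big_seq.
exact: (cvg_big add_continuous).
Qed.

Lemma cvg_prod_seq (I : Type) (r : seq I) (P : pred I) (f : I -> T -> K) (l : I -> K) :
  (forall i, P i -> f i x @[x --> F] --> l i) ->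
  \prod_(i <- r | P i) f i x @[x --> F] --> \prod_(i <- r | P i) l i.
Proof. exact: (cvg_big mul_continuous). Qed.

Lemma cvg_exprn f (l : K) n :
  f x @[x --> F] --> l -> f x ^+ n @[x --> F] --> l ^+ n.
Proof.
move=> fl; elim: n => [|n IH]; first exact: cvg_cst.
have -> : (fun x => f x ^+ n.+1) = fun x => f x * f x ^+ n.
  by apply/funext => x; rewrite exprS.
by rewrite exprS; apply: cvgM.
Qed.

Lemma near_prod_neq0 (I : eqType) (r : seq I) (f : I -> T -> K) :
  (forall i, \forall x \near F, f i x != 0) ->
  \forall x \near F, \prod_(i <- r) f i x != 0.
Proof.
move=> h; elim: r => [|i r IH]; first by apply: nearW => x; rewrite big_nil oner_neq0.
apply: filterS2 (h i) IH => x; rewrite big_cons => *; exact: mulf_neq0.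
Qed.

Lemma near_all_seq (I : eqType) (r : seq I) (P : I -> T -> Prop) :
  (forall i, \forall x \near F, P i x) ->
  \forall x \near F, forall i, i \in r -> P i x.
Proof.
move=> h; elim: r => [|i r IH]; first exact: nearW.
apply: filterS2 (h i) IH => x Pi Pr j; rewrite inE => /predU1P[->|/Pr] //.
Qed.

End Limits.

(** * Products over the rim, and general facts on the branching recursion *)

Lemma prod_rim_rows (K : numFieldType) la m (f : nat -> nat -> K) :
  is_partition la -> (size la <= m)%N ->
  \prod_(s <- boxes la | s \notin boxes (behead la)) f s.1 s.2 =
  \prod_(0 <= i < m)
    \prod_(j <- iota (nth 0%N la i.+1).+1 (nth 0%N la i - nth 0%N la i.+1))
       f i.+1 j.
Proof.
move=> pla sm; rewrite -big_filter (perm_big _ (perm_rim_rows pla sm)) /=.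
by rewrite big_allpairs_dep /index_iota subn0.
Qed.

Lemma prod_rim_columns (K : numFieldType) la (f : nat -> nat -> K) : is_partition la ->
  \prod_(s <- boxes la | s \notin boxes (behead la)) f s.1 s.2 =
  \prod_(j <- iota 1 (head 0%N la)) f (conjpart la j) j.
Proof.
by move=> pla; rewrite -big_filter (perm_big _ (perm_rim_columns pla)) big_map.
Qed.

Lemma prod_iota_reverse (K : numFieldType) l (f : int -> K) :
  \prod_(j <- iota 1 l) f (j%:Z - 1 - l%:Z) = \prod_(j <- iota 1 l) f (- j%:Z).
Proof.
have -> : iota 1 l = index_iota 1 l.+1 by rewrite /index_iota subn1.
rewrite big_nat_rev; apply: eq_big_nat => j /andP[j0 jl].
by congr f; lia.
Qed.

(** Reading the variables off a sequence on [nat] makes the widening of ordinals disappear. *)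
Lemma RstarS (K : numFieldType) (c : nat -> seq nat -> seq nat -> K -> K)
    n la (x : nat -> K) :
  Rstar c la (fun i : 'I_n.+1 => x i) =
  \sum_(ka <- subparts la | hstrip ka la)
    c n la ka (x n) * Rstar c ka (fun i : 'I_n => x i).
Proof. by []. Qed.

(** Along a chain of strips the exponents of the variables add up to the size of [la]. *)
Lemma RstarT_homogeneous (K : numFieldType) (q t c : K) n la (w : 'I_n -> K) :
  RstarT q t la (fun i => w i * c) = c ^+ sumn la * RstarT q t la w.
Proof.
rewrite /RstarT; elim: n la w => [|n IH] la w /=.
  by case: la => [|l la]; rewrite ?expr0 ?mulr0 ?mulr1.
rewrite mulr_sumr big_seq_cond [RHS]big_seq_cond; apply: eq_bigr => ka.
rewrite mem_subparts => /andP[/andP[pka ss] _].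
rewrite (IH ka (fun i => w (widen_ord (leqnSn n) i))) /cT exprMn.
have -> : c ^+ sumn la = c ^+ (sumn la - sumn ka) * c ^+ sumn ka.
  by rewrite -exprD subnK // sumn_subpart.
ring.
Qed.

Lemma C0_neq0 (K : numFieldType) (q t x : K) (la : seq nat) :
  (forall i j : int, x * q ^ i * t ^ j != 1) -> C0 q t la x != 0.
Proof.
move=> h; rewrite prodf_seq_neq0; apply/allP => s _ /=.
by rewrite subr_eq0 eq_sym mulrC mulrA h.
Qed.

(** * The contribution of the first row to the interpolation functions *)

Section FirstRow.
Variables (K : numFieldType) (q t : K).
Hypotheses (q0 : q != 0) (t0 : t != 0).
Hypothesis qt_indep : forall i j : int, q ^ i * t ^ j = 1 -> i = 0 /\ j = 0.

(** With all powers gathered in one monomial, identities between factors reduce to linear integer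
    arithmetic on exponents. *)
Definition qt (e k : int) : K := q ^ e * t ^ k.

Lemma qtM e k e' k' : qt e k * qt e' k' = qt (e + e') (k + k').
Proof. by rewrite /qt !expfzDr // mulrACA. Qed.

Lemma qtV e k : (qt e k)^-1 = qt (- e) (- k).
Proof. by rewrite /qt invfM !invr_expz. Qed.

Lemma qt_neq0 e k : qt e k != 0.
Proof. by rewrite mulf_neq0 // expfz_neq0. Qed.

Lemma qt00 : qt 0 0 = 1.
Proof. by rewrite /qt !expr0z mulr1. Qed.

Lemma qt_q : q = qt 1 0.
Proof. by rewrite /qt expr0z mulr1 expr1z. Qed.

Lemma qt_t : t = qt 0 1.
Proof. by rewrite /qt expr0z mul1r expr1z. Qed.

(** By independence of [q] and [t], [fac 0 0] is the only such factor that vanishes at b = 1. *)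
Definition fac (e k : int) (b : K) : K := 1 - qt e k / b.

Lemma fac1_neq0 e k : ~ (e = 0 /\ k = 0) -> fac e k 1 != 0.
Proof.
by move=> h; rewrite /fac divr1 subr_eq0; apply/negP => /eqP/esym/qt_indep.
Qed.

Lemma C0_cons l nu x : C0 q t (l :: nu) x =
  (\prod_(j <- iota 1 l) (1 - q ^ (j%:Z - 1) * x)) * C0 q t nu (x / t).
Proof.
rewrite /C0 boxes_cons big_cat !big_map /=; congr (_ * _).
  by apply: eq_bigr => j _; rewrite subrr expr0z mulr1.
apply: eq_bigr => -[i j] _ /=.
have -> : 1 - i.+1%:Z = (1 - i%:Z) - 1 by lia.
by rewrite (expfzDr _ _ t0) -invr_expz expr1z; ring.
Qed.

Lemma C0_skew_cons l nu ka x :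
  C0_skew q t (l :: nu) (l :: ka) x = C0_skew q t nu ka (x / t).
Proof.
rewrite /C0_skew boxes_cons big_cat !big_map /= big1_seq ?mul1r; last first.
  move=> j /andP[+]; rewrite mem_iota mem_boxes /part /=; lia.
rewrite big_seq_cond [RHS]big_seq_cond; apply: eq_big.
  case=> i j /=; case: (boolP ((i, j) \in boxes nu)) => //=.
  by rewrite mem_boxes => /andP[i0 _]; rewrite mem_boxes_cons.
move=> [i j] _ /=.
have -> : 1 - i.+1%:Z = (1 - i%:Z) - 1 by lia.
by rewrite (expfzDr _ _ t0) -invr_expz expr1z; ring.
Qed.

(** In the common first row, numerator and denominator agree factor by factor and are nonzero. In
    lower rows the row index and the column lengths all grow by one, and only their differences
    occur. *)
Lemma psi_cons l nu ka : is_partition (l :: nu) -> is_partition (l :: ka) ->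
  psi q t (l :: nu) (l :: ka) = psi q t nu ka.
Proof.
move=> pn pk; rewrite /psi boxes_cons big_cat !big_map /=.
rewrite big1_seq ?mul1r; last first.
  move=> j /andP[/eqP]; rewrite mem_iota !conjpart_cons /part /= => e jl.
  have -> : conjpart ka j = conjpart nu j by lia.
  have h c k : ~ (c = 0 /\ k = 0) -> 1 - q ^ c * t ^ k != 0.
    by move=> /fac1_neq0; rewrite /fac divr1.
  by rewrite divff // mulf_neq0 // h; lia.
rewrite big_seq_cond [RHS]big_seq_cond.
have jl i j : (i, j) \in boxes nu -> (j <= l)%N.
  rewrite mem_boxes => /and3P[_ _ h]; apply: leq_trans h _.
  exact: (nth_partition_le_head i.-1.+1 pn).
apply: eq_big => [[i j]|[i j] /andP[ij _]] /=.
  case: (boolP ((i, j) \in boxes nu)) => //= /jl jl'.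
  by rewrite !conjpart_cons jl' eqn_add2l.
rewrite !conjpart_cons (jl _ _ ij); move: ij; rewrite mem_boxes => /andP[].
by case: i.
Qed.

Lemma C0_fac mu p k b :
  C0 q t mu (q / (b * qt p k)) =
  \prod_(s <- boxes mu) fac (s.2%:Z - p) (1 - s.1%:Z - k) b.
Proof.
apply: eq_bigr => s _; rewrite /fac -/(qt _ _) invfM qtV qt_q.
rewrite [qt 1 0 * _]mulrCA [qt (_ - 1) _ * _]mulrCA [_ / b]mulrC !qtM.
by congr (1 - _ * qt _ _); lia.
Qed.

(** The first-row part of the denominator C0(q / (b v)) at v = q^p t^(-k). *)
Definition row_fac l p k b := \prod_(j <- iota 1 l) fac (j%:Z - p) k b.

Lemma row_facE l p k b : row_fac l p (- k) b =
  \prod_(j <- iota 1 l) (1 - q ^ (j%:Z - 1) * (q / (b * qt p k))).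
Proof.
apply: eq_bigr => j _; rewrite /fac invfM qtV {2}qt_q.
have -> : q ^ (j%:Z - 1) = qt (j%:Z - 1) 0 by rewrite /qt expr0z mulr1.
rewrite [qt 1 0 * _]mulrCA [qt (_ - 1) _ * _]mulrCA [_ / b]mulrC !qtM.
by congr (1 - _ * qt _ _); lia.
Qed.

(** Lowering a diagram by one row divides the argument of [C0] by t. Replacing v by t v absorbs this
    in the denominator, and the change from [n.+1], [a] to [n], [t * a] absorbs it in [C0_skew]; the
    explicit prefactor is what the first row leaves behind. *)
Lemma cE2_cons a b n l nu ka p k : is_partition (l :: nu) -> is_partition (l :: ka) ->
  cE2 q t a b n.+1 (l :: nu) (l :: ka) (qt p k) =
  t ^+ l * row_fac l p (- k - 1) b / row_fac l p (- k) b
  * cE2 q t (t * a) b n nu ka (qt p (k + 1)).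
Proof.
move=> pn pk; rewrite /cE2 psi_cons // C0_skew_cons !C0_cons.
have -> : qt p (k + 1) = t * qt p k by rewrite {1}qt_t qtM add0r addrC.
have -> : b * t * qt p k = b * qt p (k + 1).
  by rewrite -mulrA; congr (_ * _); rewrite {1}qt_t qtM add0r addrC.
rewrite -!row_facE opprD.
have -> : q / (b * qt p k) / t = q / (b * (t * qt p k)).
  by rewrite -mulrA -invfM; congr (_ / _); ring.
have -> : q / (b * qt p (k + 1)) / t = q / (b * t * (t * qt p k)).
  have -> : qt p (k + 1) = t * qt p k by rewrite {1}qt_t qtM add0r addrC.
  by rewrite -mulrA -invfM; congr (_ / _); ring.
have -> : t ^+ n.+1 * a / qt p k / t = t ^+ n * (t * a) / (t * qt p k).
  by rewrite [(t * _)^-1]invfM exprS; ring.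
rewrite (_ : sumn (l :: ka) = (l + sumn ka)%N) // exprD.
rewrite [(row_fac _ _ _ _ * _)^-1]invfM; ring.
Qed.

(** Here [p] is a function, so that [p \o S] describes the removal of the first row. *)
Definition spec_var (p : nat -> nat) (i : nat) : K := qt (p i)%:Z (- i%:Z).

Definition first_row_coef a (p : nat -> nat) l n (c : K) : K :=
  (\prod_(j <- iota 1 l) (1 - q ^ (j%:Z - 1) * (a / spec_var p 0)))
  / row_fac l (p 0%N) 0 c
  * \prod_(0 <= i < n)
      (t ^+ l * row_fac l (p i.+1) i c / row_fac l (p i.+1) i.+1 c).

(** The two products share all factors but one at each end. The cross-multiplied form stays valid
    when a factor vanishes. *)
Lemma row_facS l p k c :
  row_fac l p k c * fac (- p) k c = row_fac l (p + 1) k c * fac (l%:Z - p) k c.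
Proof.
elim: l => [|l IH]; first by rewrite /row_fac !big_nil sub0r.
rewrite /row_fac -[l.+1]addn1 iotaD !big_cat !big_seq1 /= add1n mulrAC.
rewrite -!/(row_fac _ _ _ _) IH addn1.
by congr (_ * fac _ _ _ * _); lia.
Qed.

Lemma row_facD l (p d : nat) k c :
  row_fac l p%:Z k c * \prod_(j <- iota p.+1 d) fac (1 - j%:Z) k c =
  row_fac l (p + d)%N%:Z k c
  * \prod_(j <- iota p.+1 d) fac (l%:Z + 1 - j%:Z) k c.
Proof.
elim: d => [|d IH]; first by rewrite !big_nil addn0.
rewrite -[d.+1]addn1 iotaD !big_cat !big_seq1 mulrA IH mulrAC.
have -> : 1 - (p.+1 + d)%N%:Z = - (p + d)%N%:Z by lia.
rewrite row_facS.
have -> : l%:Z + 1 - (p.+1 + d)%N%:Z = l%:Z - (p + d)%N%:Z by lia.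
have -> : (p + (d + 1))%N%:Z = (p + d)%N%:Z + 1 by lia.
by rewrite -!mulrA; congr (_ * _); rewrite mulrC.
Qed.

(** Regroups the quotients so that numerator and denominator carry the same power of t, differing
    only in consecutive values of [p]; [row_facD] then evaluates each quotient over the rim boxes of
    one row. *)
Lemma row_fac_telescope l (p : nat -> nat) m c :
  (row_fac l (p 0%N) 0 c)^-1
  * \prod_(0 <= i < m) (t ^+ l * row_fac l (p i.+1) i c / row_fac l (p i.+1) i.+1 c)
  = t ^+ (l * m) / row_fac l (p m) m c
    * \prod_(0 <= i < m) (row_fac l (p i.+1) i c / row_fac l (p i) i c).
Proof.
elim: m => [|m IH]; first by rewrite !big_nil muln0 expr0 mul1r mulrC.
by rewrite !big_nat_recr //= [LHS]mulrA IH mulnS exprD; ring.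
Qed.

(** What remains of the rim box (i, j) once its factor in [C0_skew] has cancelled against
    [fac (1 - j) (i - 1) c] up to a monomial. *)
Definition rim_term l (c : K) (i j : nat) : K :=
  - (qt (j%:Z - 1) (1 - i%:Z) * c) * fac (l%:Z + 1 - j%:Z) (i%:Z - 1) c.

(** The point of this form is that the right side is regular at c = 1: the possible zeros of the
    denominators on the left cancel row by row against the rim factors of [C0_skew]. *)
Lemma C0_skew_first_row_coef l nu m (c : K) :
  is_partition (l :: nu) -> (size nu < m)%N -> c != 0 ->
  (forall i, (i \in iota 0 m) -> row_fac l (nth 0%N (l :: nu) i) i c != 0) ->
  C0_skew q t (l :: nu) nu c
  * first_row_coef (t ^ (- m%:Z)) (nth 0%N (l :: nu)) l m c =
  (\prod_(j <- iota 1 l) (1 - qt (j%:Z - 1 - l%:Z) (- m%:Z))) * t ^+ (l * m)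
  / row_fac l 0 m c
  * \prod_(j <- iota 1 l) rim_term l c (conjpart (l :: nu) j) j.
Proof.
set la := l :: nu => pla sm c0 nz.
rewrite -(prod_rim_columns (rim_term l c) pla : _ = \prod_(j <- iota 1 l) _).
rewrite (prod_rim_rows (m := m)) //.
rewrite /C0_skew (prod_rim_rows (m := m)
  (fun i j => 1 - q ^ (j%:Z - 1) * t ^ (1 - i%:Z) * c)) //.
rewrite /first_row_coef -[_ / _ * _]mulrA row_fac_telescope.
(* Since [la] has at most [m] rows, the default value of [nth] ends the telescoping at
   [row_fac l 0 m c]. *)
have -> : nth 0%N la m = 0%N by rewrite nth_default.
have -> : \prod_(j <- iota 1 l)
            (1 - q ^ (j%:Z - 1) * (t ^ (- m%:Z) / spec_var (nth 0%N la) 0))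
        = \prod_(j <- iota 1 l) (1 - qt (j%:Z - 1 - l%:Z) (- m%:Z)).
  apply: eq_bigr => j _; rewrite /spec_var qtV oppr0.
  have -> : q ^ (j%:Z - 1) = qt (j%:Z - 1) 0 by rewrite /qt expr0z mulr1.
  have -> : t ^ (- m%:Z) = qt 0 (- m%:Z) by rewrite /qt expr0z mul1r.
  by rewrite !qtM; congr (1 - qt _ _); rewrite /=; lia.
set p := nth 0%N la.
rewrite mulrCA [X in _ * X = _]mulrCA !mulrA -mulrA; congr (_ * _).
rewrite -big_split /=; apply: eq_big_nat => i /andP[_ im].
have nzi := nz i; rewrite mem_iota /= add0n in nzi; have {}nzi := nzi im.
rewrite [LHS]mulrA; apply: (canLR (mulfK nzi)).
have pi : p i = (p i.+1 + (p i - p i.+1))%N.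
  by rewrite subnKC // nth_partitionS.
have -> : \prod_(j <- iota (p i.+1).+1 (p i - p i.+1))
    rim_term l c i.+1 j =
  \prod_(j <- iota (p i.+1).+1 (p i - p i.+1))
    (- (qt (j%:Z - 1) (- i%:Z) * c)) *
  \prod_(j <- iota (p i.+1).+1 (p i - p i.+1))
    fac (l%:Z + 1 - j%:Z) i c.
  rewrite -big_split; apply: eq_bigr => j _ /=.
  by congr (- (qt _ _ * _) * fac _ _ _); lia.
rewrite -[RHS]mulrA [X in _ = _ * X]mulrC.
have -> : row_fac l (p i) i c
        = row_fac l (p i.+1 + (p i - p i.+1))%N i c by rewrite -pi.
rewrite -row_facD.
rewrite [RHS]mulrCA [LHS]mulrC; congr (_ * _).
rewrite -big_split; apply: eq_bigr => j _ /=.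
(* With x = q^(j-1) t^(-i), this is the reflection 1 - x c = - x c (1 - 1/(x c)). *)
have -> : fac (1 - j%:Z) i c = 1 - (qt (j%:Z - 1) (- i%:Z))^-1 / c.
  by rewrite /fac qtV; congr (1 - qt _ _ / _); lia.
have -> : q ^ (j%:Z - 1) * t ^ (1 - i.+1%:Z) = qt (j%:Z - 1) (- i%:Z).
  by congr qt; lia.
by field; rewrite c0 qt_neq0.
Qed.

Lemma prod_qt (I : Type) (r : seq I) (e k : I -> int) :
  \prod_(i <- r) qt (e i) (k i) = qt (\sum_(i <- r) e i) (\sum_(i <- r) k i).
Proof.
by elim: r => [|i r IH]; rewrite ?big_nil ?qt00 // !big_cons IH qtM.
Qed.

Lemma row_fac1_neq0 l (k : nat) : row_fac l 0 k 1 != 0.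
Proof.
rewrite prodf_seq_neq0; apply/allP => j; rewrite mem_iota => /andP[j0 _] /=.
by apply: fac1_neq0 => -[]; lia.
Qed.

Lemma Cminus_cons l nu x : is_partition (l :: nu) ->
  Cminus q t (l :: nu) x =
  (\prod_(j <- iota 1 l) (1 - qt (l%:Z - j%:Z) (conjpart nu j)%:Z * x))
  * Cminus q t nu x.
Proof.
move=> pn; rewrite /Cminus boxes_cons big_cat !big_map /=; congr (_ * _).
  apply: eq_big_seq => j; rewrite mem_iota conjpart_cons => jl.
  by congr (1 - qt _ _ * _); lia.
apply: eq_big_seq => -[i j] /=; rewrite mem_boxes conjpart_cons.
case: i => // i /and3P[_ _ h].
have -> : (j <= l)%N.
  by apply: leq_trans h _; exact: (nth_partition_le_head i.+1 pn).
by congr (1 - qt _ _ * _); lia.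
Qed.

(** The limit obtained in [cvg_C0_RE2] when [mu] equals [la]. *)
Definition diag_limit la : K := Cminus q t la q / qt (sumn la) (nstat la).

(** Up to monomials, the first product cancels [row_fac l 0 m 1], and the rim terms, read by
    columns, are the first-row factors of Cminus(q). The powers of t involving [m] cancel, and the
    other monomials give q^(-l) t^(-|nu|), which matches the growth of q^|la| t^n(la). *)
Lemma diag_limit_cons l nu m : is_partition (l :: nu) ->
  (\prod_(j <- iota 1 l) (1 - qt (j%:Z - 1 - l%:Z) (- m%:Z))) * t ^+ (l * m)
  / row_fac l 0 m 1
  * \prod_(j <- iota 1 l) rim_term l 1 (conjpart (l :: nu) j) j
  * diag_limit nu = diag_limit (l :: nu).
Proof.
move=> pn; rewrite /diag_limit Cminus_cons //.
(* Reversing the order of the row turns the exponents j - 1 - l into -j. *)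
rewrite (prod_iota_reverse l (fun e => 1 - qt e (- m%:Z))).
have -> : \prod_(j <- iota 1 l) (1 - qt (- j%:Z) (- m%:Z)) =
   \prod_(j <- iota 1 l) (- qt (- j%:Z) (- m%:Z)) * row_fac l 0 m 1.
  rewrite -big_split; apply: eq_bigr => j _ /=.
  rewrite /fac divr1 subr0 mulNr mulrBr mulr1 qtM !addNr qt00; ring.
have -> : \prod_(j <- iota 1 l) rim_term l 1 (conjpart (l :: nu) j) j =
  \prod_(j <- iota 1 l) (- qt (j%:Z - 1) (- (conjpart nu j)%:Z)) *
  \prod_(j <- iota 1 l) (1 - qt (l%:Z - j%:Z) (conjpart nu j)%:Z * q).
  rewrite -big_split; apply: eq_big_seq => j; rewrite mem_iota => jl /=.
  rewrite /rim_term /fac mulr1 divr1 conjpart_cons qt_q qtM.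
  by congr (- qt _ _ * (1 - qt _ _)); lia.
have -> : t ^+ (l * m) = \prod_(j <- iota 1 l) qt 0 m.
  rewrite big_const_seq count_predT size_iota iter_mulr_1 /qt expr0z mul1r.
  by rewrite -exprnP -exprM mulnC.
rewrite [_ * row_fac _ _ _ _]mulrC -[row_fac _ _ _ _ * _ * _]mulrA.
rewrite [row_fac _ _ _ _ * _]mulrC mulfK ?row_fac1_neq0 //.
rewrite -big_split /= mulrA -big_split /=.
under eq_bigr do rewrite !mulNr mulrN opprK !qtM.
rewrite prod_qt.
have -> : \sum_(i <- iota 1 l) (- i%:Z + 0 + (i%:Z - 1)) = - l%:Z.
  under eq_bigr do rewrite addr0 addrA addNr add0r.
  by rewrite big_const_seq count_predT size_iota iter_addr_0 mulNrn natz.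
have -> : \sum_(i <- iota 1 l) (- m%:Z + m%:Z + - (conjpart nu i)%:Z)
   = - (sumn nu)%:Z.
  under eq_bigr do rewrite addNr add0r.
  rewrite sumrN -(sumn_conjpart (partition_all_le pn)).
  by rewrite (big_morph Posz PoszD (erefl 0%:Z)).
rewrite nstat_cons.
have -> : qt (l + sumn nu)%N (nstat nu + sumn nu)%N
        = qt l%:Z (sumn nu)%:Z * qt (sumn nu) (nstat nu).
  by rewrite qtM; congr qt; lia.
have -> : qt (- l%:Z) (- (sumn nu)%:Z) = (qt l (sumn nu))^-1 by rewrite qtV.
by field; rewrite !qt_neq0.
Qed.

Lemma RE2_nil a c n (x : nat -> K) :
  Rstar (cE2 q t a c) [::] (fun i : 'I_n => x i) = 1.
Proof.
elim: n => // n IH; rewrite RstarS big_mkcond big_seq1 IH.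
by rewrite /cE2 /psi /C0_skew /C0 !big_nil expr0 /hstrip /= invr1 !mulr1.
Qed.

(** * Behaviour of the interpolation functions as b tends to 1 *)

Section LimitAtOne.
Context {T : Type} {F : set_system T} {FF : Filter F}.
Variable b : T -> K.
Hypothesis b_cvg1 : b x @[x --> F] --> (1 : K).
Hypothesis b_neq1 : \forall x \near F, b x != 1.

Lemma near_b_neq0 : \forall x \near F, b x != 0.
Proof. exact: cvgr_neq0 b_cvg1 (oner_neq0 _). Qed.

Lemma cvg_fac e k : fac e k (b x) @[x --> F] --> fac e k 1.
Proof.
apply: cvgB; first exact: cvg_cst.
by apply: cvgM; [exact: cvg_cst|apply: cvgV => //; exact: oner_neq0].
Qed.

(** Every factor other than [fac 0 0] has a nonzero limit, and [fac 0 0] vanishes only at the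
    excluded value b = 1. *)
Lemma near_fac_neq0 e k : \forall x \near F, fac e k (b x) != 0.
Proof.
have [/andP[/eqP-> /eqP->]|h] := boolP ((e == 0) && (k == 0)).
  apply: filterS b_neq1 => x; rewrite /fac qt00 mul1r subr_eq0; apply: contra.
  by rewrite eq_sym invr_eq1.
have := @cvg_fac e k; move=> /cvgr_neq0; apply; apply: fac1_neq0 => -[e0 k0].
by rewrite e0 k0 eqxx in h.
Qed.

(* The zero at b = 1 of the denominator, which comes from the box (n + 1, p) of
   mu, is compensated by the box (n, p) of ka. *)
Lemma has_limit_cE2 a n (p : nat) mu ka :
  ((n.+1, p) \in boxes mu -> (n, p) \in boxes ka) ->
  has_limit (F := F) (fun x => cE2 q t a (b x) n mu ka (qt p%:Z (- n%:Z))).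
Proof.
move=> box; rewrite /cE2; apply: has_limitM; last exact: has_limit_cst.
apply: has_limitM; first exact: has_limit_cst.
pose fk s x := fac (s.2%:Z - p%:Z) (n%:Z - s.1%:Z) (b x).
pose fm s x := fac (s.2%:Z - p%:Z) (n.+1%:Z - s.1%:Z) (b x).
suff [l hl] : has_limit (F := F)
    (fun x => \prod_(s <- boxes ka) fk s x / \prod_(s <- boxes mu) fm s x).
  eexists; apply: (@cvg_near_eq _ _ _ _ _ (fun x =>
    C0_skew q t mu ka (t ^+ n * a / qt p%:Z (- n%:Z))
    * (\prod_(s <- boxes ka) fk s x / \prod_(s <- boxes mu) fm s x))).
    apply: nearW => x; rewrite -mulrA; congr (_ * (_ / _)); last first.
      by rewrite C0_fac; apply: eq_bigr => s _; congr fac; lia.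
    rewrite -[b x * t * _]mulrA [t in X in _ / X]qt_t qtM C0_fac.
    by apply: eq_bigr => s _; congr fac; lia.
  apply: cvgM; [exact: cvg_cst|exact: hl].
(* Away from the two critical boxes no denominator vanishes at b = 1. *)
have lim : has_limit (F := F) (fun x => \prod_(s <- boxes ka | s != (n, p)) fk s x
                         / \prod_(s <- boxes mu | s != (n.+1, p)) fm s x).
  eexists; apply: cvgM; first by apply: cvg_prod_seq => s _; exact: cvg_fac.
  apply: cvgV; last by apply: cvg_prod_seq => s _; exact: cvg_fac.
  rewrite prodf_seq_neq0; apply/allP => -[i j] _; apply/implyP => h.
  apply: fac1_neq0 => /= -[e k]; move/negP: h; apply; apply/eqP; congr pair; lia.
have [mb|nmb] := boolP ((n.+1, p) \in boxes mu); last first.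
  eexists; apply: cvgM; first by apply: cvg_prod_seq => s _; exact: cvg_fac.
  apply: cvgV; last by apply: cvg_prod_seq => s _; exact: cvg_fac.
  rewrite prodf_seq_neq0; apply/allP => -[i j] ij /=.
  apply: fac1_neq0 => /= -[e k]; move/negP: nmb; apply.
  by have -> : (n.+1, p) = (i, j) by congr pair; lia.
case: lim => l hl; exists l; apply: cvg_near_eq hl.
(* Both critical factors equal [fac 0 0], so their quotient is 1 near the limit point. *)
apply: filterS (near_fac_neq0 0 0) => x f0.
rewrite (bigD1_seq _ (box mb) (boxes_uniq _)) (bigD1_seq _ mb (boxes_uniq _)) /=.
by rewrite /fk /fm !subrr -mulf_div divff ?mul1r.
Qed.

(** Passing to a subpartition never lengthens the first row, so at the first variable the critical
    box (1, p 0) lies outside the diagram. At later variables [hstrip_boxes] provides the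
    compensating box. *)
Lemma has_limit_RE2 a p mu n : is_partition mu -> (head 0%N mu < p 0%N)%N ->
  has_limit (F := F)
    (fun x => Rstar (cE2 q t a (b x)) mu (fun i : 'I_n => spec_var p i)).
Proof.
elim: n mu => [|n IH] mu pmu hp; first exact: has_limit_cst.
under eq_fun do rewrite RstarS.
apply: has_limit_sum => ka; rewrite mem_subparts => /andP[pka ss] hs.
apply: has_limitM; last first.
  by apply: IH => //; apply: leq_ltn_trans hp; apply: subpart_head.
apply: has_limit_cE2; case: n {IH} => [|n]; last exact: hstrip_boxes.
by rewrite mem_boxes /part nth0; lia.
Qed.

(* Only chains of horizontal strips whose first rows are all equal to l
   contribute to the pole at b = 1; removing these rows leaves the chains of nu. *)
Lemma has_limit_RE2_first_row a p l nu n :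
  is_partition (l :: nu) -> p 0%N = l ->
  has_limit (F := F) (fun x =>
    Rstar (cE2 q t a (b x)) (l :: nu) (fun i : 'I_n.+1 => spec_var p i)
    - first_row_coef a p l n (b x)
      * Rstar (cE2 q t (t * a) (b x)) nu
          (fun i : 'I_n => spec_var (p \o S) i)).
Proof.
move=> + pl; have sv0 : spec_var p 0 = qt l 0 by rewrite /spec_var pl oppr0.
elim: n nu => [|n IH] nu pn.
  (* With a single variable only the empty partition can contribute to the branching sum, and the
     difference is identically zero. *)
  eexists; apply: (@cvg_near_eq _ _ _ _ _ (fun=> 0)); last exact: cvg_cst.
  apply: nearW => x; apply/eqP; rewrite subr_eq0; apply/eqP.
  rewrite RstarS big_mkcond (bigD1_seq [::]) ?subparts_uniq ?mem_subparts //=.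
  rewrite big1 ?addr0; last by move=> ka /negbTE ->; rewrite mulr0 if_same.
  rewrite mulr1 /first_row_coef big_nil mulr1; case: nu pn => [|k nu] pn.
    have -> : hstrip [::] [:: l].
      by apply/(hstripP _ pn); split=> // j _; rewrite conjpart_cons /conjpart /=; lia.
    rewrite mulr1 /cE2 [psi _ _ _ _]big1_seq; last first.
      by move=> [i j] /andP[] /=; rewrite mem_boxes /conjpart /part;
         case: i => [|[|i]] //=; rewrite ?nth_nil; lia.
    have skE y : C0_skew q t [:: l] [::] y = C0 q t [:: l] y.
      by rewrite -(@C0_skewE _ _ _ _ [::]) // [C0 _ _ [::] _]big_nil mulr1.
    rewrite expr0 mulr1 !mul1r skE !C0_cons ![C0 _ _ [::] _]big_nil !mulr1 sv0.
    by rewrite pl -row_facE oppr0.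
  (* The first column would lose at least two boxes. *)
  have -> : hstrip [::] [:: l, k & nu] = false.
    apply/negbTE/negP => /hstripP-/(_ pn)[_ /(_ 1%N isT)].
    move: pn; rewrite !is_partition_cons /conjpart /=; lia.
  by rewrite mulr0.
(* The branching sum is split by whether the first row is kept; on the kept part, [cE2_cons]
   reproduces the last factor of [first_row_coef]. *)
have E x : Rstar (cE2 q t a (b x)) (l :: nu) (fun i : 'I_n.+2 => spec_var p i)
    - first_row_coef a p l n.+1 (b x)
      * Rstar (cE2 q t (t * a) (b x)) nu (fun i : 'I_n.+1 => spec_var (p \o S) i)
  = \sum_(ka <- subparts nu | hstrip ka nu)
      cE2 q t a (b x) n.+1 (l :: nu) (l :: ka) (spec_var p n.+1)
      * (Rstar (cE2 q t a (b x)) (l :: ka) (fun i : 'I_n.+1 => spec_var p i)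
         - first_row_coef a p l n (b x)
         * Rstar (cE2 q t (t * a) (b x)) ka (fun i : 'I_n => spec_var (p \o S) i))
    + \sum_(ka <- subparts (l :: nu) | hstrip ka (l :: nu) && (head 0%N ka != l))
        cE2 q t a (b x) n.+1 (l :: nu) ka (spec_var p n.+1)
        * Rstar (cE2 q t a (b x)) ka (fun i : 'I_n.+1 => spec_var p i).
  rewrite !RstarS (bigID (fun ka => head 0%N ka == l)) /= -big_filter.
  rewrite (perm_big _ (perm_hstrips_same_head pn)) /= big_map big_filter addrAC.
  congr (_ + _); under [RHS]eq_bigr do rewrite mulrBr.
  rewrite sumrB; congr (_ - _); rewrite mulr_sumr.
  rewrite big_seq_cond [RHS]big_seq_cond; apply: eq_bigr => ka.
  rewrite mem_subparts => /andP[/andP[pka ss] hs].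
  have plk := is_partition_cons_subpart pn pka ss.
  rewrite cE2_cons // /first_row_coef big_nat_recr //=.
  have -> : spec_var (p \o S) n = qt (p n.+1) (- n.+1%:Z + 1).
    by congr qt; lia.
  have -> : - - n.+1%:Z - 1 = n%:Z by lia.
  by rewrite opprK; ring.
rewrite (funext E); apply: has_limitD.
  apply: has_limit_sum => ka; rewrite mem_subparts => /andP[pka ss] hs.
  have plk := is_partition_cons_subpart pn pka ss.
  apply: has_limitM; last exact: IH.
  by apply: has_limit_cE2; apply: hstrip_boxes; rewrite ?hstrip_cons.
apply: has_limit_sum => ka; rewrite mem_subparts => /andP[pka ss] /andP[hs hl].
apply: has_limitM; first by apply: has_limit_cE2; apply: hstrip_boxes.
apply: has_limit_RE2 => //; rewrite pl ltn_neqAle hl.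
exact: subpart_head ss.
Qed.

Lemma cvg_C0 mu (f : T -> K) (y : K) :
  f x @[x --> F] --> y -> C0 q t mu (f x) @[x --> F] --> C0 q t mu y.
Proof.
move=> fy; apply: cvg_prod_seq => s _; apply: cvgB; first exact: cvg_cst.
by apply: cvgM => //; exact: cvg_cst.
Qed.

Lemma cvg_C0_RE2 la mu m :
  is_partition la -> mu \in subparts la -> (size la < m)%N ->
  C0 q t la (b x)
  * Rstar (cE2 q t (t ^ (1 - m%:Z)) (b x)) mu (fun i : 'I_m => spec_var (nth 0%N la) i)
    @[x --> F] --> (mu == la)%:R * diag_limit la.
Proof.
elim: la mu m => [|l nu IH] mu m pla.
  rewrite inE => /eqP -> _; rewrite eqxx mul1r.
  have -> : diag_limit [::] = 1.
    by rewrite /diag_limit /Cminus /nstat !big_nil qt00 divr1.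
  apply: (@cvg_near_eq _ _ _ _ _ (fun=> 1)); last exact: cvg_cst.
  by apply: nearW => x; rewrite RE2_nil /C0 big_nil mulr1.
have l0 : (0 < l)%N by move: pla; rewrite is_partition_cons => /andP[].
rewrite mem_subparts => /andP[pmu smu] sm; case: m sm => // m sm.
(* The zero at 1 comes from the box (1, 1). *)
have C00 : C0 q t (l :: nu) (b x) @[x --> F] --> (0 : K).
  have <- : C0 q t (l :: nu) 1 = 0; last exact: cvg_C0.
  by rewrite C0_cons; case: (l) l0 => // k _;
     rewrite big_cons expr0z mulr1 subrr !mul0r.
have [hl|] := ltnP (head 0%N mu) l.
  have -> : (mu == l :: nu) = false.
    by apply/negP => /eqP e; rewrite e ltnn in hl.
  have [v hv] := has_limit_RE2 (t ^ (1 - m.+1%:Z)) (p := nth 0%N (l :: nu)) m.+1 pmu hl.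
  have -> : false%:R * diag_limit (l :: nu) = 0 * v by rewrite !mul0r.
  exact: cvgM.
have := subpart_head smu; case: mu pmu smu => [|k mu] pmu smu /=; first by case: (l) l0.
move=> kl lk; have {kl lk} kl : k = l by apply/eqP; rewrite eqn_leq kl lk.
rewrite {}kl in pmu smu *; move: smu; rewrite subpart_cons leqnn /= => smu.
have pnu := partition_behead pla.
have mus : mu \in subparts nu by rewrite mem_subparts smu (partition_behead pmu).
have {}IH := IH _ m pnu mus sm.
rewrite eqseq_cons eqxx /= -(diag_limit_cons m pla) mulrCA.
(* The difference has a finite limit, so [C0] sends it to 0 and only the first-row term remains. *)
have [v hv] := has_limit_RE2_first_row (t ^ (1 - m.+1%:Z))
  (p := nth 0%N (l :: nu)) m pmu erefl.
have {hv} := cvgM C00 hv; rewrite mul0r => /(_ FF) hv.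
rewrite -[X in _ --> X]addr0.
set V := (X in X * (_ * _) + 0).
(* [C0] of [la] is split as [C0_skew] times [C0] of [nu]: the former regularizes [first_row_coef],
   the latter is what the induction hypothesis requires. *)
suff main : (C0_skew q t (l :: nu) nu (b x)
   * first_row_coef (t ^ (- m%:Z)) (nth 0%N (l :: nu)) l m (b x))
  * (C0 q t nu (b x) * Rstar (cE2 q t (t ^ (1 - m%:Z)) (b x)) mu
       (fun i : 'I_m => spec_var (nth 0%N nu) i))
  @[x --> F] --> V * ((mu == nu)%:R * diag_limit nu).
  have := cvgD main hv => /(_ FF); apply: cvg_near_eq; apply: nearW => x /=.
  rewrite -(C0_skewE q t (b x) (subpart_behead pla)).
  (* The shifted parameter t a is the one prescribed for [nu] with one variable fewer, so the
     induction closes. *)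
  have -> : t * t ^ (1 - m.+1%:Z) = t ^ (1 - m%:Z).
    by rewrite -{1}[t]expr1z -expfzDr //; congr (_ ^ _); lia.
  have -> : 1 - m.+1%:Z = - m%:Z by lia.
  rewrite -[spec_var (nth 0%N (l :: nu) \o S)]/(spec_var (nth 0%N nu)) /=; ring.
apply: cvgM; last exact: IH.
apply: (@cvg_near_eq _ _ _ _ _ (fun x =>
  (\prod_(j <- iota 1 l) (1 - qt (j%:Z - 1 - l%:Z) (- m%:Z))) * t ^+ (l * m)
  / row_fac l 0 m (b x)
  * \prod_(j <- iota 1 l) rim_term l (b x) (conjpart (l :: nu) j) j)).
  have nz : \forall x \near F, forall i, i \in iota 0 m ->
      row_fac l (nth 0%N (l :: nu) i) i (b x) != 0.
    by apply: near_all_seq => i; apply: near_prod_neq0 => j; apply: near_fac_neq0.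
  apply: filterS2 near_b_neq0 nz => x bx nz.
  exact: C0_skew_first_row_coef.
apply: cvgM.
  apply: cvgM; first exact: cvg_cst.
  apply: cvgV; first exact: row_fac1_neq0.
  by apply: cvg_prod_seq => j _; exact: cvg_fac.
apply: cvg_prod_seq => j _; apply: cvgM; last exact: cvg_fac.
by apply: cvgN; apply: cvgM => //; exact: cvg_cst.
Qed.

End LimitAtOne.
End FirstRow.

(** * The Pastro sum as B tends to q *)

Unset Implicit Arguments.

Theorem mainTheorem3 (K : numFieldType) (q t A sq : K)
    (hgen : generic A q t) (hsq : sq ^+ 2 = q)
    (n : nat) (hn : (1 <= n)%N)
    (la : seq nat) (hla : is_partition la) (hlen : (size la <= n)%N)
    (m : nat) (hm : (size la < m)%N)
    (w : 'I_n -> K) :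
  pastro q t sq m la w A B @[B --> q^'] -->
    Cminus q t la t / C0 q t la (t ^+ n)
    * (A * sq^-1 * t ^ (n%:Z - 1)) ^+ sumn la
    * t ^- nstat la
    * RstarT q t la w.
Proof.
case: hgen => q0 t0 qt_indep A_indep.
have sq0 : sq != 0 by apply: contraNneq q0 => s0; rewrite -hsq s0 expr0n.
have Bq : (fun B : K => B) B @[B --> q^'] --> q by apply: cvg_within; exact: cvg_id.
have b1 : B / q @[B --> q^'] --> (1 : K).
  by rewrite -(divff q0); apply: cvgM => //; exact: cvg_cst.
have bn1 : \forall B \near q^', B / q != 1.
  apply: filterS (nbhs_dnbhs_neq q) => B; apply: contra => /eqP h.
  by rewrite -[B](divfK q0) h mul1r.
have C0A : C0 q t la (t ^ (n%:Z - 1) * A) != 0.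
  apply: C0_neq0 => i j.
  suff -> : t ^ (n%:Z - 1) * A * q ^ i * t ^ j = A * q ^ i * t ^ (n%:Z - 1 + j) by [].
  by rewrite [t ^ (_ + j)]expfzDr //; ring.
(* The extra q makes every exponent of q at least 1, so independence applies. *)
have Cq0 : Cminus q t la q != 0.
  rewrite prodf_seq_neq0; apply/allP => -[i j]; rewrite mem_boxes => /and3P[_ _ jl] /=.
  rewrite subr_eq0 eq_sym mulrAC -[q in X in X * _]expr1z -expfzDr //.
  by apply/negP => /eqP/qt_indep[]; lia.
(* Each summand is divided into [X], continuous at B = q, and [Y], whose limit is given by
   [cvg_C0_RE2]. *)
pose X mu B :=
  (A * t ^ (n%:Z - 1)) ^+ sumn la / C0 q t la (t ^ (n%:Z - 1) * A * (B / q))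
  * (q ^+ sumn mu * t ^+ nstat mu / Cminus q t mu q
     * (Cminus q t mu t * C0 q t mu (A * t ^ (n%:Z - 1)) / C0 q t mu (t ^+ n)))
  * ((sq / B) ^+ sumn mu * RstarT q t mu w) * t ^- nstat mu.
pose Y mu B := C0 q t la (B / q)
  * Rstar (cE2 q t (t ^ (1 - m%:Z)) (B / q)) mu
      (fun i : 'I_m => spec_var q t (nth 0%N la) i).
apply: (@cvg_near_eq _ _ _ _ _ (fun B => \sum_(mu <- subparts la) Y mu B * X mu B)).
  (* C0(q / B) occurs in the binomial numerator and in the Pastro denominator. It may vanish at B =
     q but not nearby, so it cancels on the punctured neighbourhood. *)
  have nz : \forall B \near q^', forall mu,
      mu \in subparts la -> C0 q t mu (B / q)^-1 != 0.
    apply: near_all_seq => mu; apply: near_prod_neq0 => s.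
    exact: (near_fac_neq0 qt_indep b1 bn1).
  apply: filterS nz => B nz; rewrite /pastro mulr_sumr; apply: eq_big_seq => mu /nz nzm.
  rewrite RstarT_homogeneous.
  have RE : RstarE2 q t mu (fun i : 'I_m => q ^+ part la i.+1 * t ^ (1 - i.+1%:Z))
      (t ^ (1 - m%:Z)) (B / q) = Rstar (cE2 q t (t ^ (1 - m%:Z)) (B / q)) mu
      (fun i : 'I_m => spec_var q t (nth 0%N la) i).
    rewrite /RstarE2; congr Rstar; apply/funext => i; congr (_ * t ^ _); lia.
  rewrite /binomE2 RE /Y /X invf_div in nzm *.
  rewrite RstarT_homogeneous [(C0 q t mu (t ^+ n) * _)^-1]invfM.
  rewrite -[t ^ _ * A * B / q]mulrA [(sq / B) ^+ _]exprMn.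
  by rewrite -[RHS]mulr1 -[X in _ = _ * X](mulfV nzm); ring.
have limX mu : X mu B @[B --> q^'] --> X mu q.
  apply: cvgM; last exact: cvg_cst.
  apply: cvgM.
    apply: cvgM; last exact: cvg_cst.
    apply: cvgM; first exact: cvg_cst.
    apply: cvgV; first by rewrite divff // mulr1.
    apply: cvg_C0; apply: cvgM; first exact: cvg_cst.
    by rewrite divff.
  apply: cvgM; last exact: cvg_cst.
  by apply: cvg_exprn; apply: cvgM; [exact: cvg_cst|exact: cvgV].
(* Of the limiting sum only the term [mu = la] survives, and there [diag_limit] cancels Cminus(q)
   and the powers of q and t in [X]. *)
have -> : Cminus q t la t / C0 q t la (t ^+ n) * (A * sq^-1 * t ^ (n%:Z - 1)) ^+ sumn la
    * t ^- nstat la * RstarT q t la w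
  = \sum_(mu <- subparts la) (mu == la)%:R * diag_limit q t la * X mu q.
  rewrite (bigD1_seq la) ?subparts_uniq ?mem_subparts ?hla //=; last first.
    by apply/allP.
  rewrite eqxx big1 ?addr0 => [|mu /negbTE ->]; last by rewrite !mul0r.
  rewrite /X /diag_limit /qt divff // mulr1.
  have -> : A * t ^ (n%:Z - 1) = t ^ (n%:Z - 1) * A by rewrite mulrC.
  have -> : sq / q = sq^-1 by rewrite -hsq; field.
  rewrite !exprMn -!exprnP mul1r.
  have u0 : q ^+ sumn la != 0 by rewrite expf_neq0.
  have v0 : t ^+ nstat la != 0 by rewrite expf_neq0.
  move: (C0 q t la (t ^+ n))^-1 (sq^-1 ^+ _) (C0 q t la _) C0A => d e f f0.
  move: (q ^+ _) (t ^+ _) u0 v0 => u v u0 v0.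
  by field; rewrite Cq0 u0 v0 f0.
apply: cvg_sum_seq => mu mus; apply: cvgM => //.
exact: (cvg_C0_RE2 q0 t0 qt_indep b1 bn1).
Qed.
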